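(* Let $k$ be a field of characteristic $0$, let $R=k[x,y,z]$ with irrelevant maximal ideal $\mathfrak{m}=(x,y,z)$, and let $I\subset R$ be the ideal generated by the $2\times 2$ minors of a general (random) $2\times 3$ matrix of linear forms in $R$. Then for every $d\ge 1$ the annihilator of the $R$-module $I^{(d)}/I^d$ is $\mathfrak{m}^{e}$, where $e=\lfloor d/2\rfloor$ is the greatest integer $\le d/2$.
   Context: ''General matrix of linear forms'' means: there is a nonempty Zariski-open subset of the affine space $k^{18}$ of coefficients of the six entries (six linear forms in three variables) such that the assertion (for all $d\geq 1$) holds for every matrix whose coefficient vector lies in it. The symbolic power $I^{(d)}$ is the contraction to $R$ of $T^{-1}I^d$, where $T$ is the complement of the union of the associated primes of $R/I$. *)

(* Defs.v *)
From mathcomp Require Import all_boot all_order all_algebra.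
From mathcomp Require Import boolp classical_sets.
From mathcomp Require Import mpoly.

Set Implicit Arguments.
Unset Strict Implicit.
Unset Printing Implicit Defensive.

Import GRing.Theory.

Local Open Scope classical_set_scope.
Local Open Scope ring_scope.

Section Ideals.
Variable R : comNzRingType.
Implicit Types (I J N M S T P : set R) (d : nat).

(* The ideal generated by S. *)
Definition ideal_gen S : set R :=
  [set x | exists (n : nat) (c s : 'I_n -> R),
     (forall i, S (s i)) /\ x = \sum_(i < n) c i * s i].

(* I^d; for d = 0 the only generator is the empty product, so I^0 = R. *)
Definition ideal_pow I d : set R :=
  ideal_gen [set x | exists f : 'I_d -> R,
                (forall i, I (f i)) /\ x = \prod_(i < d) f i].

(* The annihilator of the subquotient N / M: r kills the class of every
   element of N, i.e. r * f = 0 modulo M for all f in N. *)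
Definition annihilator_quot N M : set R :=
  [set r | forall f, N f -> M (r * f)].

(* P is a prime ideal ([idealr_closed] includes properness) and is the
   annihilator of the class of some f in R / I. *)
Definition associated_prime I P : Prop :=
  [/\ idealr_closed (mem P), prime_idealr_closed (mem P)
    & exists f : R, P = [set r | I (r * f)]].

Definition compl_assoc_primes I : set R :=
  ~` \bigcup_(P in [set P | associated_prime I P]) P.

(* The contraction to R of the ideal T^-1 J of T^-1 R: those f such that
   f / 1 = a / t in T^-1 R for some a in J and t in T, with the equality of
   fractions spelled out. *)
Definition localization_contraction T J : set R :=
  [set f | exists a t u, [/\ J a, T t, T u & u * (t * f - a) = 0]].

Definition symbolic_pow I d : set R :=
  localization_contraction (compl_assoc_primes I) (ideal_pow I d).

(* The r x r minors of M; rows and columns are taken in increasing order. *)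
Definition minors (m n r : nat) (M : 'M[R]_(m, n)) : set R :=
  [set x | exists (f : 'I_r -> 'I_m) (g : 'I_r -> 'I_n),
     [/\ {homo f : i j / (i < j)%N}, {homo g : i j / (i < j)%N}
       & x = \det (mxsub f g M)]].

End Ideals.

Definition irrelevant_ideal (k : fieldType) (n : nat) : set {mpoly k[n]} :=
  ideal_gen [set x | exists i : 'I_n, x = 'X_i].

(* Zariski-open subsets of affine space k^n: complements of the zero loci of
   arbitrary sets of polynomials. *)
Definition zariski_open (k : fieldType) (n : nat) (U : set ('I_n -> k)) : Prop :=
  exists S : set {mpoly k[n]}, U = ~` [set v | forall p, S p -> p.@[v] = 0].

(* The 2 x 3 matrix of linear forms in three variables with coefficient vector
   v in k^18: the coefficient of 'X_l in the entry (i, j) is the coordinate of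
   v with index 9 i + 3 j + l, which runs through 0, ..., 17 exactly once. *)
Definition linear_form_matrix (k : fieldType) (v : 'I_18 -> k) :
    'M[{mpoly k[3]}]_(2, 3) :=
  \matrix_(i < 2, j < 3) \sum_(l < 3) v (inord (9 * i + 3 * j + l)) *: 'X_l.

(* Main.v *)
Require Import Defs.
From mathcomp Require Import all_boot all_order all_algebra all_field.
From mathcomp Require Import boolp classical_sets.
From mathcomp Require Import mpoly.
From mathcomp Require Import zify ring.

(** Let C_0 and C_1 be the 3 x 3 coefficient matrices of the two rows of the
    given matrix, and let G = adj(C_1) C_0.  If C_1 is invertible and the
    characteristic polynomial of G has simple roots, then over a splitting field
    L of that polynomial the two matrices are simultaneously diagonal: in
    suitable linear coordinates y_0, y_1, y_2, and after an invertible operation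
    on columns, the rows become (d_j y_j)_j and (y_j)_j with distinct d_j.  So I
    generates in L[y] the ideal K = (y_0 y_1, y_0 y_2, y_1 y_2) of the three
    coordinate points [splitting_coordinates].  The points may well be conjugate
    over k, which is why L is needed; but L[y] is a free k[x]-module, so
    membership in an ideal of k[x] can be tested after extension to L[y]
    [extensionP, extension_contract].

    In L[y] everything is monomial.  A polynomial is in K^d if and only if each
    of its monomials has degree at least d in the two variables other than y_i,
    for each i, and total degree at least 2d [coord_points_powP].  An element of
    k[x] lies outside the associated primes of I if and only if it vanishes at
    none of the three points [compl_assoc_primesP], hence the elements of I^(d)
    satisfy the first three conditions.  Adding these three shows that their
    monomials have degree at least 3d/2.  With e = floor(d/2), multiplication by
    an element of m^e brings the degree to at least 2d, so m^e annihilates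
    I^(d)/I^d [irrelevant_pow_annihilates].  Conversely the monomial
    y_0^(d-e) y_1^(d-e) y_2^e satisfies the three conditions and has degree only
    2d - e.  Its coordinates over k[x] lie in I^(d), because a power of a linear
    form that vanishes at none of the points multiplies it into K^d; if r sends
    them all to I^d then the monomials of r have degree at least e
    [annihilator_sub].

    The Zariski-open set is the complement of the hypersurface
    det(C_1) det(c'(G)) = 0, where c is the characteristic polynomial of G; the
    second factor is, up to sign, the discriminant of c [pencil_disc]. *)

Set Implicit Arguments.
Unset Strict Implicit.
Unset Printing Implicit Defensive.

Import GRing.Theory.

Local Open Scope classical_set_scope.
Local Open Scope ring_scope.

(** * Ideals and their powers *)

Section IdealTheory.
Variable R : comNzRingType.
Implicit Types (I J M S : set R) (a x y : R).

(** The unit ideal is included, in contrast to [idealr_closed]. *)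
Definition ideal_closed M : Prop :=
  M 0 /\ forall a x y, M x -> M y -> M (a * x + y).

Lemma ideal_closedM M a x : ideal_closed M -> M x -> M (a * x).
Proof. by case=> M0 Ml Mx; rewrite -[a * x]addr0; apply: Ml. Qed.

Lemma ideal_closed_sum M (T : Type) (r : seq T) (P : pred T) (F : T -> R) :
  ideal_closed M -> (forall i, P i -> M (F i)) -> M (\sum_(i <- r | P i) F i).
Proof.
move=> [M0 Ml] MF; apply: (big_ind M) => // x y Mx My.
by rewrite -[x]mul1r; apply: Ml.
Qed.

Lemma ideal_gen_closed S : ideal_closed (ideal_gen S).
Proof.
split; first by exists 0%N, (fun=> 0), (fun=> 0); split=> [[]//|]; rewrite big_ord0.
move=> a _ _ [n1 [c1 [s1 [Ss1 ->]]]] [n2 [c2 [s2 [Ss2 ->]]]].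
exists (n1 + n2)%N.
exists (fun i => match fintype.split i with inl j => a * c1 j | inr j => c2 j end).
exists (fun i => match fintype.split i with inl j => s1 j | inr j => s2 j end).
split=> [i|]; first by case: (fintype.split i).
rewrite big_split_ord mulr_sumr; congr (_ + _); apply: eq_bigr => i _.
  case: split_ordP => j; first by move/lshift_inj<-; rewrite mulrA.
  by move/eqP; rewrite eq_lrshift.
by case: split_ordP => j; [move/esym/eqP; rewrite eq_lrshift|move/rshift_inj<-].
Qed.

Lemma ideal_gen0 S : ideal_gen S 0.
Proof. by case: (ideal_gen_closed S). Qed.

Lemma ideal_gen_incl S x : S x -> ideal_gen S x.
Proof. by move=> Sx; exists 1%N, (fun=> 1), (fun=> x); rewrite big_ord1 mul1r. Qed.

Lemma ideal_gen_min S M : ideal_closed M -> S `<=` M -> ideal_gen S `<=` M.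
Proof.
move=> clM SM _ [n [c [s [Ss ->]]]].
by apply: ideal_closed_sum => // i _; apply: ideal_closedM => //; apply: SM.
Qed.

Lemma ideal_pow_closed I d : ideal_closed (ideal_pow I d).
Proof. exact: ideal_gen_closed. Qed.

Lemma ideal_pow_prod I d (f : 'I_d -> R) :
  (forall i, I (f i)) -> ideal_pow I d (\prod_i f i).
Proof. by move=> If; apply: ideal_gen_incl; exists f. Qed.

Lemma ideal_colon_closed M x : ideal_closed M -> ideal_closed [set y | M (y * x)].
Proof.
case=> M0 Ml; split=> [|a y z My Mz] /=; first by rewrite mul0r.
by rewrite mulrDl -mulrA; apply: Ml.
Qed.

Lemma ideal_powM I (a b : nat) x y :
  ideal_pow I a x -> ideal_pow I b y -> ideal_pow I (a + b) (x * y).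
Proof.
move=> Ix; move: y; apply: ideal_gen_min.
  have := ideal_colon_closed x (ideal_pow_closed I (a + b)).
  by congr (ideal_closed _); apply/funext => y /=; rewrite mulrC.
move=> _ [g [Ig ->]] /=; move: x Ix; apply: ideal_gen_min.
  exact/ideal_colon_closed/ideal_pow_closed.
move=> _ [f [If ->]] /=; apply: ideal_gen_incl.
exists (fun i => match fintype.split i with inl j => f j | inr j => g j end).
split=> [i|]; first by case: (fintype.split i).
rewrite big_split_ord; congr (_ * _); apply: eq_bigr => i _.
  by case: split_ordP => j; [move/lshift_inj<-|move/eqP; rewrite eq_lrshift].
by case: split_ordP => j; [move/esym/eqP; rewrite eq_lrshift|move/rshift_inj<-].
Qed.

Lemma ideal_pow0 I x : ideal_pow I 0 x.
Proof.
rewrite -[x]mulr1; apply: ideal_closedM; first exact: ideal_pow_closed.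
by apply: ideal_gen_incl; exists (fun=> 0); split=> [[]//|]; rewrite big_ord0.
Qed.

Lemma ideal_powX I d x : I x -> ideal_pow I d (x ^+ d).
Proof.
move=> Ix; have := @ideal_pow_prod I d (fun=> x).
by rewrite prodr_const card_ord; apply.
Qed.

Lemma ideal_pow1 I : ideal_closed I -> ideal_pow I 1 `<=` I.
Proof. by move=> clI; apply: ideal_gen_min => // _ [f [If ->]]; rewrite big_ord1. Qed.

Lemma ideal_powW I c d : (c <= d)%N -> ideal_pow I d `<=` ideal_pow I c.
Proof.
move=> le_cd; rewrite -(subnKC le_cd); apply: ideal_gen_min.
  exact: ideal_pow_closed.
move=> _ [f [If ->]]; rewrite big_split_ord /= mulrC.
by apply: ideal_closedM; [apply: ideal_pow_closed | apply: ideal_pow_prod].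
Qed.

(** A factor is a combination of generators, and for fixed other factors the
    elements x with x * y in M form an ideal, so the factors can be replaced by
    generators one at a time. *)
Lemma ideal_pow_gen_min S d M : ideal_closed M ->
    (forall s : 'I_d -> R, (forall i, S (s i)) -> M (\prod_i s i)) ->
  ideal_pow (ideal_gen S) d `<=` M.
Proof.
move=> clM SM; apply: ideal_gen_min => // _ [f [Sf ->]].
elim: d => [|d IHd] in M clM SM f Sf *.
  by have := SM f; rewrite !big_ord0; apply; case.
rewrite big_ord_recl mulrC.
apply: (IHd [set y | M (y * f ord0)]) => [|s Ss|i] //=.
  exact: ideal_colon_closed.
rewrite mulrC; move: (f ord0) (Sf ord0); apply: ideal_gen_min.
  exact: ideal_colon_closed.
move=> x Sx /=.
pose t i := if unlift ord0 i is Some j then s j else x.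
have -> : x * \prod_i s i = \prod_i t i.
  rewrite big_ord_recl /t unlift_none; congr (_ * _).
  by apply: eq_bigr => i _; rewrite liftK.
by apply: SM => i; rewrite /t; case: (unlift ord0 i).
Qed.

End IdealTheory.

(** * Filtration by the weight of monomials *)

Section WeightFiltration.
Variables (n : nat) (L : fieldType).
Local Notation A := {mpoly L[n]}.
Implicit Types (w : 'I_n -> nat) (f g h : A) (m : 'X_{1..n}).

Definition weight w m : nat := (\sum_i w i * m i)%N.

Definition weight_ge w d : set A :=
  [set f | forall m, f@_m != 0 -> (d <= weight w m)%N].

(** The substitution of t^(w i) X_i for X_i: its coefficient at t^j is the
    homogeneous component of weight j. *)
Definition graded w : A -> {poly A} :=
  locked (mmap (polyC \o mpolyC n (R := L)) (fun i => ('X_i)%:P * 'X^(w i))).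

Lemma gradedD w f g : graded w (f + g) = graded w f + graded w g.
Proof. by rewrite /graded -lock raddfD. Qed.

Lemma gradedM w f g : graded w (f * g) = graded w f * graded w g.
Proof. by rewrite /graded -lock rmorphM. Qed.

Lemma coef_graded w f i m :
  ((graded w f)`_i)@_m = if i == weight w m then f@_m else 0.
Proof.
have gradedZX c m' : graded w (c *: 'X_[m']) = (c *: 'X_[m'])%:P * 'X^(weight w m').
  rewrite /graded -lock mmapZ mmapX /mmap1 /=.
  under eq_bigr do rewrite exprMn -exprM -polyC_exp.
  rewrite big_split /= prodrXr -rmorph_prod /= -mpolyXE_id mulrA -polyCM mul_mpolyC.
  by rewrite /weight.
elim/mpolyind: f => [|c m' p _ _ IHp].
  by rewrite /graded -lock raddf0 coef0 !mcoeff0 if_same.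
rewrite gradedD coefD !mcoeffD gradedZX {}IHp coefCM coefXn mulr_natr mcoeffMn.
rewrite mcoeffZ mcoeffX; case: (eqVneq m' m) => [->|_].
  by case: eqP; rewrite ?addr0.
by rewrite !mulr0 mul0rn !add0r.
Qed.

Lemma weight_geP w d f : weight_ge w d f <-> forall i, (i < d)%N -> (graded w f)`_i = 0.
Proof.
split=> [Vf i lt_id|Vf m].
  apply/mpolyP => m; rewrite coef_graded mcoeff0; case: eqP => // Di.
  by apply: contraTeq lt_id => /Vf; rewrite -Di -leqNgt.
by apply: contraNleq => /Vf/(congr1 (mcoeff m)); rewrite coef_graded eqxx mcoeff0 => ->.
Qed.

Lemma weight_ge_closed w d : ideal_closed (weight_ge w d).
Proof.
split=> [m|a x y]; first by rewrite mcoeff0 eqxx.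
move=> /weight_geP Vx /weight_geP Vy; apply/weight_geP => i lt_id.
rewrite gradedD gradedM coefD Vy // coefM big1 ?addr0 // => j _.
by rewrite Vx ?mulr0 // (leq_ltn_trans (leq_subr _ _)).
Qed.

Lemma weight_geMl w d f g : weight_ge w d g -> weight_ge w d (f * g).
Proof. exact: (ideal_closedM _ (weight_ge_closed _ _)). Qed.

Lemma weight_geM w c d f g :
  weight_ge w c f -> weight_ge w d g -> weight_ge w (c + d) (f * g).
Proof.
move=> /weight_geP Vf /weight_geP Vg; apply/weight_geP => i lt_i.
rewrite gradedM coefM big1 // => j _.
have [lt_jc|le_cj] := ltnP j c; first by rewrite Vf ?mul0r.
by rewrite Vg ?mulr0 //; have := ltn_ord j; lia.
Qed.

(** The component of h of weight s is nonzero, and the first nonzero component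
    of f is multiplied by it in f * h without any other contribution. *)
Lemma weight_ge_cancel w s d f h : weight_ge w s h -> ~ weight_ge w s.+1 h ->
  weight_ge w (d + s) (f * h) -> weight_ge w d f.
Proof.
move=> Vh nVh Vfh; apply/weight_geP; elim/ltn_ind => i IHi lt_id.
have /weight_geP hs := Vh; have /weight_geP/(_ (i + s)%N) := Vfh.
rewrite gradedM coefM (bigD1 (inord i)) //= inordK ?ltnS ?leq_addr // addKn.
rewrite big1 ?addr0 => [|j nji]; last first.
  have [lt_ji|lt_ij|eq_ji] := ltngtP j i; first by rewrite IHi ?mul0r // (ltn_trans lt_ji).
    by rewrite hs ?mulr0 //; have := ltn_ord j; lia.
  by case/eqP: nji; apply: val_inj; rewrite /= inordK ?ltnS ?leq_addr.
rewrite ltn_add2r => /(_ lt_id)/eqP; rewrite mulf_eq0 => /orP[/eqP//|/eqP hs0].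
case: nVh; apply/weight_geP => j; rewrite ltnS leq_eqVlt => /orP[/eqP->//|].
exact: hs.
Qed.

Lemma weight_ge0 w f : weight_ge w 0 f. Proof. by []. Qed.

Lemma ideal_pow_weight_ge w I c d :
  I `<=` weight_ge w c -> ideal_pow I d `<=` weight_ge w (d * c).
Proof.
move=> IV; apply: ideal_gen_min; first exact: weight_ge_closed.
move=> _ [f [If ->]]; elim: d f If => [|d IHd] f If; first exact: weight_ge0.
by rewrite big_ord_recl mulSn; apply: weight_geM; [apply: IV | apply: IHd].
Qed.

Lemma weight_geX w m d : weight_ge w d 'X_[m] <-> (d <= weight w m)%N.
Proof.
split=> [|le_d m']; first by apply; rewrite mcoeffX eqxx oner_neq0.
by rewrite mcoeffX; case: (eqVneq m m') => [<- //|_]; rewrite eqxx.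
Qed.

Lemma ideal_closed_monomials M f : ideal_closed M ->
  (forall m, f@_m != 0 -> M 'X_[m]) -> M f.
Proof.
move=> clM Mm; rewrite [f]mpolyE big_seq; apply: ideal_closed_sum => // m.
rewrite mcoeff_msupp => /Mm Mf; rewrite -mul_mpolyC.
exact: ideal_closedM.
Qed.

(** A monomial of degree at least d is a product of at least d variables. *)
Lemma irrelevant_powE d : ideal_pow (@irrelevant_ideal L n) d = weight_ge (fun=> 1%N) d.
Proof.
apply/seteqP; split.
  rewrite -{2}[d]muln1; apply: ideal_pow_weight_ge; apply: ideal_gen_min.
    exact: weight_ge_closed.
  move=> _ [i ->]; apply/weight_geX; rewrite /weight (bigD1 i) //= mnm1E eqxx; lia.
move=> f Vf; apply: ideal_closed_monomials => [|m /Vf]; first exact: ideal_pow_closed.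
move=> /ideal_powW; apply; rewrite mpolyXE_id /weight.
apply: (big_ind2 (ideal_pow (@irrelevant_ideal L n))) => [|e1 x1 e2 x2|i _].
- exact: ideal_pow0.
- exact: ideal_powM.
- by rewrite mul1n; apply: ideal_powX; apply: ideal_gen_incl; exists i.
Qed.

End WeightFiltration.

(** * The ideal of the three coordinate points *)

Section CoordinatePoints.
Variable L : fieldType.
Local Notation A := {mpoly L[3]}.
Implicit Types (f g : A) (m : 'X_{1..3}) (i j : 'I_3).

Let o0 : 'I_3 := @Ordinal 3 0 isT.
Let o1 : 'I_3 := @Ordinal 3 1 isT.
Let o2 : 'I_3 := @Ordinal 3 2 isT.

Definition coord_points_ideal : set A :=
  ideal_gen [set x | exists i j, i != j /\ x = 'X_i * 'X_j].

(** The weight for which the elements of weight at least d are the d-th power of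
    the prime ideal of the i-th coordinate point. *)
Definition deg_off i : 'I_3 -> nat := fun j => (j != i).

Definition total_degree : 'I_3 -> nat := fun=> 1%N.

Lemma ord3_ind (P : 'I_3 -> Prop) : P o0 -> P o1 -> P o2 -> forall i, P i.
Proof.
move=> P0 P1 P2 [[|[|[|//]]] lt_i3].
- by rewrite (_ : Ordinal lt_i3 = o0); last exact: val_inj.
- by rewrite (_ : Ordinal lt_i3 = o1); last exact: val_inj.
- by rewrite (_ : Ordinal lt_i3 = o2); last exact: val_inj.
Qed.

Lemma big_ord3 (T : Type) (idx : T) (op : Monoid.law idx) (F : 'I_3 -> T) :
  \big[op/idx]_i F i = op (F o0) (op (F o1) (F o2)).
Proof.
rewrite !big_ord_recl big_ord0 Monoid.mulm1.
by congr (op (F _) (op (F _) (F _))); apply: val_inj.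
Qed.

Lemma weight3E w m : weight w m = (w o0 * m o0 + (w o1 * m o1 + w o2 * m o2))%N.
Proof. by rewrite /weight big_ord3. Qed.

(** Each variable is counted by two of the three weights, so summing the three
    bounds shows that the monomials of f have degree at least 3d/2. *)
Lemma deg_off_total d f g : (forall i, weight_ge (deg_off i) d f) ->
  weight_ge total_degree (d./2) g -> weight_ge total_degree (d * 2) (f * g).
Proof.
move=> Vf Vg; have -> : (d * 2 = uphalf (d * 3) + d./2)%N by lia.
apply: weight_geM => // m fm; have := Vf o0 m fm; have := Vf o1 m fm.
by have := Vf o2 m fm; rewrite !weight3E /deg_off /total_degree /=; lia.
Qed.

(** The monomial is a multiple of (y_1 y_2)^a0 (y_0 y_2)^a1 (y_0 y_1)^a2 with
    a0 + a1 + a2 = d as soon as a_i >= d - m_i for each i.  Such a_i exist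
    because the sum of the truncated differences d - m_i is at most d: this is
    the bound on m_i + m_j if two of them are positive, and the bound on the
    total degree if all three are. *)
Lemma mpolyX_coord_points_pow m d :
    (forall i, d <= weight (deg_off i) m)%N -> (d * 2 <= weight total_degree m)%N ->
  ideal_pow coord_points_ideal d 'X_[m].
Proof.
move=> le_off; have := (le_off o2, le_off o1, le_off o0); rewrite !weight3E.
rewrite /deg_off /total_degree /= => -[[le2 le1] le0] le_tot.
(* a2 absorbs what remains of d, which is at least d - m o2. *)
pose a0 := (d - m o0)%N; pose a1 := (d - m o1)%N; pose a2 := (d - a0 - a1)%N.
have Ka i j a : i != j -> ideal_pow coord_points_ideal a (('X_i * 'X_j) ^+ a).
  by move=> nij; apply/ideal_powX/ideal_gen_incl; exists i, j.
have := ideal_powM (ideal_powM (Ka o1 o2 a0 isT) (Ka o0 o2 a1 isT)) (Ka o0 o1 a2 isT).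
have -> : (a0 + a1 + a2 = d)%N by rewrite /a2 /a1 /a0; lia.
have -> : 'X_[m] = 'X_o0 ^+ (m o0 - (a1 + a2)) * 'X_o1 ^+ (m o1 - (a0 + a2)) *
    'X_o2 ^+ (m o2 - (a0 + a1)) *
    (('X_o1 * 'X_o2) ^+ a0 * ('X_o0 * 'X_o2) ^+ a1 * ('X_o0 * 'X_o1) ^+ a2) :> A.
  rewrite mpolyXE_id big_ord3 /=.
  rewrite -{1}(@subnK (a1 + a2) (m o0)) ?exprD; last by rewrite /a2 /a1 /a0; lia.
  rewrite -{1}(@subnK (a0 + a2) (m o1)) ?exprD; last by rewrite /a2 /a1 /a0; lia.
  rewrite -{1}(@subnK (a0 + a1) (m o2)) ?exprD; last by rewrite /a2 /a1 /a0; lia.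
  rewrite !exprMn; ring.
exact: (ideal_closedM _ (ideal_pow_closed _ _)).
Qed.

Lemma coord_points_powP d f : ideal_pow coord_points_ideal d f <->
  (forall i, weight_ge (deg_off i) d f) /\ weight_ge total_degree (d * 2) f.
Proof.
split=> [Kf|[Vf Wf]].
  split=> [i|]; [rewrite -[d]muln1|]; move: f Kf; apply: ideal_pow_weight_ge;
    apply: ideal_gen_min; try exact: weight_ge_closed;
    move=> _ [j [l [njl ->]]]; rewrite -mpolyXD; apply/weight_geX;
    rewrite weight3E !mnmDE !mnm1E /deg_off /total_degree.
    by move: i j l njl; do 3!apply: ord3_ind.
  by move: j l njl; do 2!apply: ord3_ind.
apply: ideal_closed_monomials => [|m fm]; first exact: ideal_pow_closed.
by apply: mpolyX_coord_points_pow => [i|]; [apply: Vf | apply: Wf].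
Qed.

Lemma coord_pointsP f :
  coord_points_ideal f <-> forall i, weight_ge (deg_off i) 1 f.
Proof.
split=> [Kf i|Vf].
  have: ideal_pow coord_points_ideal 1 f.
    by apply: ideal_gen_incl; exists (fun=> f); rewrite big_ord1.
  by case/coord_points_powP.
apply: ideal_pow1; first exact: ideal_gen_closed.
apply/coord_points_powP; split=> //; rewrite -[f]mulr1.
exact: (@deg_off_total 1).
Qed.

End CoordinatePoints.

(** * Extension of ideals along a free ring extension *)

Section FreeExtension.
Variables (R A : comNzRingType) (phi : {rmorphism R -> A}).
Implicit Types (I J : set R) (f : R) (g : A).

Definition extension J : set A := ideal_gen (phi @` J).

(** The family e is a basis of the R-module A and pi gives the coordinates; the
    last clause is what contraction of extended ideals to R relies on. *)
Definition free_basis n (e : 'I_n -> A) (pi : 'I_n -> {additive A -> R}) : Prop :=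
  [/\ forall j f g, pi j (phi f * g) = f * pi j g,
      forall g, g = \sum_j phi (pi j g) * e j
    & exists j, pi j (e j) = 1].

Lemma preimage_closed M : ideal_closed M -> ideal_closed (phi @^-1` M).
Proof.
case=> M0 Ml; split=> [|a x y Mx My] /=; first by rewrite rmorph0.
by rewrite rmorphD rmorphM; apply: Ml.
Qed.

Lemma extension_incl J f : J f -> extension J (phi f).
Proof. by move=> Jf; apply: ideal_gen_incl; exists f. Qed.

Lemma extension_pow J d : extension (ideal_pow J d) = ideal_pow (extension J) d.
Proof.
apply/seteqP; split.
  apply: ideal_gen_min => [|_ [f Jf <-]]; first exact: ideal_pow_closed.
  move: f Jf; apply: ideal_gen_min; first exact/preimage_closed/ideal_pow_closed.
  move=> _ [s [Js ->]] /=; rewrite rmorph_prod; apply: ideal_pow_prod => i.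
  exact: extension_incl.
apply: ideal_pow_gen_min => [|s Js]; first exact: ideal_gen_closed.
have [r Jr Dr] := fin_all_exists2 Js; under eq_bigr do rewrite -Dr.
by rewrite -rmorph_prod; apply/extension_incl/ideal_pow_prod.
Qed.

Section Basis.
Variables (n : nat) (e : 'I_n -> A) (pi : 'I_n -> {additive A -> R}).
Hypothesis basis_e : free_basis e pi.

Lemma extensionP J g : ideal_closed J -> extension J g <-> forall j, J (pi j g).
Proof.
move=> clJ; have [piM e_sum _] := basis_e; split=> [[m [c [s [Js ->]]]] j|Jg].
  rewrite raddf_sum; apply: ideal_closed_sum => // i _.
  by have [f Jf <-] := Js i; rewrite mulrC piM mulrC; apply: ideal_closedM.
rewrite (e_sum g); apply: ideal_closed_sum => [|j _]; first exact: ideal_gen_closed.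
rewrite mulrC; apply: ideal_closedM; first exact: ideal_gen_closed.
exact: extension_incl.
Qed.

(** The coordinate of phi f * e j at j is f. *)
Lemma extension_contract J f : ideal_closed J -> extension J (phi f) -> J f.
Proof.
move=> clJ Jf; have [piM _ [j pi_ej]] := basis_e.
rewrite -[f]mulr1 -pi_ej -piM; apply: (iffLR (extensionP _ clJ)).
by rewrite mulrC; apply: ideal_closedM => //; apply: ideal_gen_closed.
Qed.

End Basis.
End FreeExtension.

(** * The annihilator when I becomes the ideal of the coordinate points *)

Section ThreePoints.
Variables (k L : fieldType) (phi : {rmorphism {mpoly k[3]} -> {mpoly L[3]}}).
Variables (n : nat) (e : 'I_n -> {mpoly L[3]}).
Variable pi : 'I_n -> {additive {mpoly L[3]} -> {mpoly k[3]}}.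
Hypothesis basis_e : free_basis phi e pi.
Variable I : set {mpoly k[3]}.
Hypotheses (clI : ideal_closed I) (extI : extension phi I = @coord_points_ideal L).
Hypothesis ext_irr : extension phi (@irrelevant_ideal k 3) = @irrelevant_ideal L 3.
Implicit Types (f g t : {mpoly k[3]}) (i : 'I_3).

Local Notation vanishes_at i := (weight_ge (deg_off i) 1).

Lemma off_weight_cancel i d (f g : {mpoly L[3]}) : ~ vanishes_at i f ->
  weight_ge (deg_off i) d (f * g) -> weight_ge (deg_off i) d g.
Proof.
move=> nVf Vfg; apply: (@weight_ge_cancel _ _ _ 0 d g f) => //.
by rewrite addn0 mulrC.
Qed.

(** The ideal of the points is the intersection of their prime ideals. *)
Lemma three_pointsP f : I f <-> forall i, vanishes_at i (phi f).
Proof.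
rewrite -coord_pointsP -extI.
by split; [apply: extension_incl | apply: (extension_contract basis_e)].
Qed.

(** The colon ideal (I : g) is the ideal of those points at which g does not
    vanish.  Multiplying g by b when a * b is in (I : g) but a and b are not
    makes this set of points smaller, so the process stops at a g for which
    (I : g) is prime. *)
Lemma ex_associated_prime t g : ~ I g -> I (t * g) ->
  exists2 P, associated_prime I P & P t.
Proof.
pose nz g := #|[pred i | ~~ `[< vanishes_at i (phi g) >]]|.
have [N] := ubnP (nz g); elim: N g => // N IHN g lt_g nIg Itg.
pose P : set {mpoly k[3]} := [set r | I (r * g)].
have memI (x : {mpoly k[3]}) : P x -> x \in mem P by move/mem_set.
have memE (x : {mpoly k[3]}) : x \in mem P -> P x by move/set_mem.
have [prP|] := pselect (forall a b, P (a * b) -> P a \/ P b).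
  exists P => //; split; last by exists g.
    split=> [||a u v].
    + by apply: memI; rewrite /P /= mul0r; case: clI.
    + by apply/negP => /memE; rewrite /P /= mul1r.
    + move=> /memE Pu /memE Pv; apply: memI.
      by have [_] := ideal_colon_closed g clI; apply.
  by move=> a b /memE/prP[Pa|Pb]; apply/orP; [left|right]; apply: memI.
move/existsNP => [a /existsNP[b /not_implyP[Pab /not_orP[nPa nPb]]]].
have Itbg : I (t * (b * g)) by rewrite mulrCA; apply: ideal_closedM.
rewrite ltnS in lt_g; apply: (IHN (b * g) _ nPb Itbg); apply: leq_trans lt_g.
apply: proper_card; apply/properP; split.
  apply/fintype.subsetP => i; rewrite !inE; apply: contra => /asboolP Vg; apply/asboolP.
  by rewrite rmorphM; apply: weight_geMl.
apply: contra_notP nPa => no_i; apply/three_pointsP => i.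
rewrite rmorphM; apply: contra_notP no_i => nVag.
have nVa : ~ vanishes_at i (phi a).
  apply: contra_not nVag => Va; rewrite mulrC.
  by apply: weight_geMl.
have nVg : ~ vanishes_at i (phi g).
  apply: contra_not nVag => Vg.
  by apply: weight_geMl.
exists i; rewrite !inE; first exact/asboolP.
apply/negPn/asboolP; apply: (off_weight_cancel nVa); rewrite -rmorphM.
by rewrite mulrA; apply: (iffLR (three_pointsP _)).
Qed.

(** If t vanishes at the i-th point then t annihilates y_i modulo K, hence the
    coordinates of y_i modulo I, and these are not all in I. *)
Lemma compl_assoc_primesP t :
  compl_assoc_primes I t <-> forall i, ~ vanishes_at i (phi t).
Proof.
split=> [Tt i Vt|nVt [P [[_ P1 _] _ [f defP]] Pt]]; last first.
  have Itf : I (t * f) by have := Pt; rewrite defP.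
  have If : I f.
    apply/three_pointsP => i; apply: (off_weight_cancel (nVt i)).
    by rewrite -rmorphM; apply: (iffLR (three_pointsP _)).
  by case/negP: P1; apply: mem_set; rewrite defP /= mul1r.
have ItX (j : 'I_n) : I (t * pi j 'X_i).
  have [piM _ _] := basis_e; rewrite -piM.
  apply: (iffLR (extensionP basis_e _ clI)); rewrite extI; apply/coord_pointsP => l.
  have [->|nli] := eqVneq l i.
    by rewrite mulrC; apply: weight_geMl.
  apply: weight_geMl.
  by apply/weight_geX; rewrite /weight (bigD1 i) //= mnm1E /deg_off eq_sym nli eqxx.
have [j nIX] : exists j, ~ I (pi j 'X_i).
  apply/existsNP => /(extensionP basis_e _ clI); rewrite extI => /coord_pointsP/(_ i).
  move/weight_geX; rewrite /weight big1 // => j _; rewrite mnm1E /deg_off eq_sym.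
  by case: eqP.
by have [P assP Pt] := ex_associated_prime nIX (ItX j); apply: Tt; exists P.
Qed.

(** Some multiple t * f with t nonvanishing at the i-th point lies in I^d, and
    such a t does not affect the order of vanishing there. *)
Lemma symbolic_pow_weight d f i : symbolic_pow I d f -> weight_ge (deg_off i) d (phi f).
Proof.
case=> a [t [u [Ia /compl_assoc_primesP nVt /compl_assoc_primesP nVu utfa]]].
have nz_u : u != 0.
  apply/eqP => u0; case: (nVu i); rewrite u0 rmorph0.
  by case: (weight_ge_closed L (deg_off i) 1).
move/eqP: utfa; rewrite mulf_eq0 (negPf nz_u) subr_eq0 => /eqP tf_a.
apply: (off_weight_cancel (nVt i)); rewrite -rmorphM tf_a.
have: ideal_pow (@coord_points_ideal L) d (phi a).
  by rewrite -extI -extension_pow; apply: extension_incl.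
by case/coord_points_powP.
Qed.

Lemma irrelevant_pow_annihilates d f r : symbolic_pow I d f ->
  ideal_pow (@irrelevant_ideal k 3) d./2 r -> ideal_pow I d (r * f).
Proof.
move=> If mr; apply: (extension_contract basis_e); first exact: ideal_pow_closed.
rewrite extension_pow extI rmorphM mulrC; apply/coord_points_powP; split=> [i|].
  rewrite mulrC; apply: weight_geMl.
  exact: symbolic_pow_weight.
apply: deg_off_total => [i|]; first exact: symbolic_pow_weight.
rewrite -irrelevant_powE -ext_irr -extension_pow.
exact: extension_incl.
Qed.

(** The exponent of a monomial that lies in the d-th power of the prime ideal of
    each point and whose degree falls short of 2d by floor(d/2), the most that
    is possible. *)
Definition extremal d : 'X_{1..3} :=
  [multinom (if i == ord_max then d./2 else d - d./2)%N | i < 3].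

(** The coordinates of the extremal monomial are in I^(d), by the multiplier
    t^floor(d/2).  So r times this monomial is in K^d, which forces the missing
    degree on r. *)
Lemma annihilator_sub d r t : @irrelevant_ideal k 3 t -> compl_assoc_primes I t ->
  annihilator_quot (symbolic_pow I d) (ideal_pow I d) r ->
  ideal_pow (@irrelevant_ideal k 3) d./2 r.
Proof.
move=> mt Tt ann_r; have [piM e_sum _] := basis_e; pose m := extremal d.
have le_off i : weight_ge (deg_off i) d ('X_[m] : {mpoly L[3]}).
  apply/weight_geX; rewrite weight3E !mnmE /deg_off.
  by move: i; apply: ord3_ind => /=; lia.
have tot_m : weight total_degree m = (d * 2 - d./2)%N.
  by rewrite weight3E !mnmE /total_degree /=; lia.
have Vt : weight_ge total_degree d./2 (phi (t ^+ d./2)).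
  rewrite -irrelevant_powE -ext_irr -extension_pow.
  exact/extension_incl/ideal_powX.
have Tte : compl_assoc_primes I (t ^+ d./2).
  apply/compl_assoc_primesP => i; have /compl_assoc_primesP/(_ i) nVt := Tt.
  elim: (d./2) => [|c IHc]; last by rewrite exprS rmorphM => /(off_weight_cancel nVt).
  rewrite expr0 rmorph1 -mpolyX0 => /weight_geX; rewrite /weight big1 // => j _.
  by rewrite mnm0E muln0.
have Ipi (j : 'I_n) : ideal_pow I d (t ^+ d./2 * pi j 'X_[m]).
  rewrite -piM; apply: (iffLR (extensionP basis_e _ (ideal_pow_closed _ _))).
  rewrite extension_pow extI; apply/coord_points_powP; split=> [i|].
    by apply: weight_geMl.
  by rewrite mulrC; apply: deg_off_total.
have T1 : compl_assoc_primes I 1.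
  apply/compl_assoc_primesP => i; rewrite rmorph1 -mpolyX0 => /weight_geX.
  by rewrite /weight big1 // => j _; rewrite mnm0E muln0.
have Irpi (j : 'I_n) : ideal_pow I d (r * pi j 'X_[m]).
  apply: ann_r; exists (t ^+ d./2 * pi j 'X_[m]), (t ^+ d./2), 1; split=> //.
  by rewrite subrr mulr0.
have: ideal_pow (@coord_points_ideal L) d (phi r * 'X_[m]).
  rewrite -extI -extension_pow.
  by apply/(extensionP basis_e _ (ideal_pow_closed _ _)) => j; rewrite piM.
case/coord_points_powP => _; rewrite (_ : d * 2 = d./2 + weight total_degree m)%N; last first.
  by rewrite tot_m; lia.
move=> Vrm; have : weight_ge total_degree d./2 (phi r).
  apply: weight_ge_cancel Vrm; first exact/weight_geX.
  by move/weight_geX; rewrite ltnn.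
rewrite -irrelevant_powE -ext_irr -extension_pow.
by apply: (extension_contract basis_e); apply: ideal_pow_closed.
Qed.

End ThreePoints.

(** * Splitting fields *)

Section SplittingField.

Lemma ex_irreducible_factor (F : fieldType) (p : {poly F}) : (1 < size p)%N ->
  exists2 r, r %| p & irreducible_poly r.
Proof.
have [N] := ubnP (size p); elim: N p => // N IHN p le_pN p_gt1.
have [irr_p|] := pselect (forall q : {poly F}, size q != 1%N -> q %| p -> q %= p).
  by exists p => //; split.
case/existsNP => q /not_implyP[q_neq1 /not_implyP[q_dv_p /negP q_neqp]].
have nz_p : p != 0 by rewrite -size_poly_gt0 ltnW.
have nz_q : q != 0 by apply: dvdpN0 q_dv_p nz_p.
have lt_qp : (size q < size p)%N.
  by rewrite ltn_neqAle dvdp_leq // andbT dvdp_size_eqp.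
have [||r r_dv_q irr_r] := IHN q; last by exists r => //; apply: dvdp_trans q_dv_p.
  by rewrite ltnS in le_pN; apply: leq_trans le_pN.
by rewrite ltn_neqAle eq_sym q_neq1 size_poly_gt0.
Qed.

(** Adjoin a root of an irreducible factor and divide by the corresponding
    linear factor. *)
Lemma ex_splitting_field (F : fieldType) (p : {poly F}) : p != 0 ->
  exists (L : fieldExtType F) (zs : seq L),
    map_poly (in_alg L) p %= \prod_(z <- zs) ('X - z%:P).
Proof.
have [N] := ubnP (size p); elim: N F p => // N IHN F p le_pN nz_p.
have [p_le1|p_gt1] := leqP (size p) 1.
  exists F^o, [::]; rewrite big_nil -size_poly_eq1 size_map_poly.
  by rewrite eqn_leq p_le1 size_poly_gt0.
have [r r_dv_p irr_r] := ex_irreducible_factor p_gt1.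
have [K _ [x rx0 _]] := irredp_FAdjoin irr_r.
have /factor_theorem[q Dp] : root (map_poly (in_alg K) p) x.
  by rewrite -(divpK r_dv_p) rmorphM rootM rx0 orbT.
have nz_q : q != 0.
  apply: contraNneq nz_p => q0; move/eqP: Dp; rewrite q0 mul0r.
  by rewrite map_poly_eq0.
have lt_qN : (size q < N)%N.
  move: le_pN; rewrite -(size_map_poly (in_alg K)) Dp ltnS.
  by rewrite size_mul ?polyXsubC_eq0 // size_XsubC addn2.
have [L [zs Dq]] := IHN K q lt_qN nz_q.
exists (baseFieldType L), (in_alg L x :: zs).
have -> : map_poly (in_alg (baseFieldType L)) p
    = map_poly (in_alg L) (map_poly (in_alg K) p).
  by rewrite -map_poly_comp; apply: eq_map_poly => a /=; apply: baseField_scaleE.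
rewrite Dp rmorphM /= rmorphB /= map_polyX map_polyC big_cons mulrC.
exact: eqp_mull.
Qed.

End SplittingField.

(** * Diagonalization of matrices with simple eigenvalues *)

Section Eigenvalues.
Variables (F : fieldType) (n : nat).
Implicit Types (G P : 'M[F]_n.+1) (p : {poly F}).

Lemma mulmx_horner_eigen G (v : 'rV[F]_n.+1) c p :
  v *m G = c *: v -> v *m horner_mx G p = p.[c] *: v.
Proof.
move=> Gv; elim/poly_ind: p => [|p a IHp].
  by rewrite rmorph0 mulmx0 horner0 scale0r.
rewrite rmorphD rmorphM /= horner_mx_X horner_mx_C mulmxDr mulmxA IHp.
by rewrite -scalemxAl Gv scalerA mul_mx_scalar -scalerDl hornerMXaddC.
Qed.

Lemma uniq_of_simple_roots (rs : seq F) (p := \prod_(z <- rs) ('X - z%:P)) :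
  (forall c, root p c -> p^`().[c] != 0) -> uniq rs.
Proof.
rewrite {}/p; elim: rs => //= c rs; rewrite big_cons.
set q := \prod_(z <- rs) _ => IHrs simple.
have Dp : (('X - c%:P) * q)^`() = q + ('X - c%:P) * q^`().
  by rewrite derivM derivXsubC mul1r.
rewrite -root_prod_XsubC IHrs ?andbT => [|x qx0].
  have := simple c; rewrite rootM root_XsubC eqxx Dp !hornerE subrr mul0r addr0.
  by move/(_ isT).
have := simple x; rewrite rootM qx0 orbT Dp !hornerE => /(_ isT).
by move/eqP: qx0 => ->; rewrite add0r mulf_eq0 => /norP[].
Qed.

Lemma char_poly_similar P G H : P \in unitmx -> P *m G = H *m P ->
  char_poly G = char_poly H.
Proof.
rewrite unitmxE unitfE => nzP PG.
have nzdetP : \det (map_mx polyC P) != 0 by rewrite det_map_mx polyC_eq0.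
apply: (mulfI nzdetP); rewrite [RHS]mulrC -!det_mulmx; congr (\det _).
by rewrite /char_poly_mx mulmxBr mulmxBl -!map_mxM PG scalar_mxC.
Qed.

(** At an eigenvalue c, the matrix p'(G), with p the characteristic polynomial,
    has an eigenvector for p'(c).  If it is invertible then the roots of p are
    simple. *)
Lemma diagonalize_separable G (rs : seq F) :
    char_poly G = \prod_(z <- rs) ('X - z%:P) ->
    \det (horner_mx G (char_poly G)^`()) != 0 ->
  exists (Q : 'M[F]_n.+1) (d : 'rV[F]_n.+1),
    [/\ Q \in unitmx, G *m Q = Q *m diag_mx d & injective (d 0)].
Proof.
move=> DG nz_disc.
have simple c : root (char_poly G) c -> (char_poly G)^`().[c] != 0.
  rewrite -eigenvalue_root_char => /eigenvalueP[v Gv nz_v].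
  apply: contraNneq nz_disc => dc0; apply/det0P; exists v => //.
  by rewrite (mulmx_horner_eigen _ Gv) dc0 scale0r.
have Urs : uniq rs by apply: uniq_of_simple_roots; rewrite -DG.
have [P Punit /similar_diagPex[d /(similarP Punit) PG]] : diagonalizable G.
  by apply/diagonalizableP; exists rs; rewrite // -DG mxminpoly_dvd_char.
exists (invmx P), d; split; first by rewrite unitmx_inv.
  by rewrite -[G in LHS](mulKmx Punit) PG -!mulmxA mulmxV // mulmx1.
have Dd : char_poly G = \prod_(z <- [seq d 0 i | i <- enum 'I_n.+1]) ('X - z%:P).
  rewrite (char_poly_similar Punit PG) char_poly_trig ?diag_mx_is_trig // big_map.
  by rewrite big_enum /=; apply: eq_bigr => i _; rewrite !mxE eqxx.
have Ud : uniq [seq d 0 i | i <- enum 'I_n.+1].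
  by apply: uniq_of_simple_roots; rewrite -Dd.
by apply/injectiveP; rewrite /injectiveb /dinjectiveb.
Qed.

End Eigenvalues.

(** * Extension of scalars and linear change of coordinates *)

Section LinearBaseChange.
Variables (k : fieldType) (L : fieldExtType k) (n : nat).

Definition linear_subst (M : 'M[L]_n) : n.-tuple {mpoly L[n]} :=
  [tuple \sum_i M l i *: 'X_i | l < n].

Definition base_change (M : 'M[L]_n) : {rmorphism {mpoly k[n]} -> {mpoly L[n]}} :=
  comp_mpoly (linear_subst M) \o map_mpoly (in_alg L).

Lemma linear_substX M (i : 'I_n) : 'X_i \mPo linear_subst M = \sum_j M i j *: 'X_j.
Proof. by rewrite comp_mpolyXU -tnth_nth tnth_mktuple. Qed.

(** Composition of linear substitutions is multiplication of matrices. *)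
Lemma linear_substK M N (p : {mpoly L[n]}) : N *m M = 1%:M ->
  (p \mPo linear_subst N) \mPo linear_subst M = p.
Proof.
move=> NM1; elim/mpolyind: p => [|c m p _ _ IHp]; first by rewrite !comp_mpoly0.
rewrite !comp_mpolyD IHp !comp_mpolyZ; congr (_ *: _ + _).
rewrite mpolyXE_id !rmorph_prod /=; apply: eq_bigr => i _.
rewrite !rmorphXn /=; congr (_ ^+ _); rewrite linear_substX raddf_sum /=.
transitivity (\sum_l (N *m M) i l *: 'X_l : {mpoly L[n]}).
  under [RHS]eq_bigr do rewrite mxE scaler_suml.
  rewrite exchange_big; apply: eq_bigr => j _ /=.
  rewrite comp_mpolyZ linear_substX scaler_sumr.
  by apply: eq_bigr => l _; rewrite scalerA.
rewrite NM1 (bigD1 i) //= big1 ?addr0 => [|l nli]; first by rewrite mxE eqxx scale1r.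
by rewrite mxE eq_sym (negPf nli) scale0r.
Qed.

Lemma map_mpolyZ_lin (c : {linear L -> k^o}) (f : {mpoly k[n]}) (g : {mpoly L[n]}) :
  map_mpoly c (map_mpoly (in_alg L) f * g) = f * map_mpoly c g.
Proof.
apply/mpolyP => m; rewrite mcoeff_map_mpoly !mcoeffM raddf_sum /=.
apply: eq_bigr => -[m1 m2] _ /=.
by rewrite !mcoeff_map_mpoly /= mulr_algl linearZ.
Qed.

Lemma mpoly_vbasisE (h : {mpoly L[n]}) (b := vbasis {: L}) :
  h = \sum_j map_mpoly (in_alg L) (map_mpoly (coord b j) h) * (b`_j)%:MP_[n].
Proof.
apply/mpolyP => m; rewrite [RHS]raddf_sum /= {1}(coord_vbasis (memvf h@_m)).
apply: eq_bigr => j _.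
by rewrite mulrC mul_mpolyC mcoeffZ !mcoeff_map_mpoly mulrC mulr_algl.
Qed.

Lemma base_changeX M (l : 'I_n) : base_change M 'X_l = \sum_i M l i *: 'X_i.
Proof. by rewrite /base_change /= map_mpolyX linear_substX. Qed.

(** A basis of L over k is one of L[x] over k[x], and the linear change of
    coordinates is an automorphism that fixes L. *)
Lemma base_change_free M N : N *m M = 1%:M -> M *m N = 1%:M ->
  exists d (e : 'I_d -> {mpoly L[n]})
         (pi : 'I_d -> {additive {mpoly L[n]} -> {mpoly k[n]}}),
    free_basis (base_change M) e pi.
Proof.
move=> NM1 MN1; pose b := vbasis {: L}.
exists (\dim {: L}), (fun j => (b`_j)%:MP_[n]).
exists (fun j => map_mpoly (coord b j) \o comp_mpoly (linear_subst N)).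
split=> [j f g|g|].
- by rewrite /= rmorphM /= (linear_substK _ MN1) map_mpolyZ_lin.
- rewrite -{1}(linear_substK g NM1) [in LHS](mpoly_vbasisE (g \mPo _)) raddf_sum /=.
  by apply: eq_bigr => j _; rewrite rmorphM /= comp_mpolyC.
have lt0d : (0 < \dim {: L})%N := adim_gt0 {: L}%AS.
exists (Ordinal lt0d); move: (Ordinal lt0d) => j.
have bj1 : coord b j b`_j = 1.
  by rewrite coord_free ?eqxx // (basis_free (vbasisP _)).
by rewrite /= comp_mpolyC map_mpolyC /= bj1 mpolyC1.
Qed.

Lemma extension_irrelevant M N : N *m M = 1%:M ->
  extension (base_change M) (@irrelevant_ideal k n) = @irrelevant_ideal L n.
Proof.
move=> NM1; apply/seteqP; split; apply: ideal_gen_min; try exact: ideal_gen_closed.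
  move=> _ [f mf <-]; move: f mf; apply: ideal_gen_min.
    exact/preimage_closed/ideal_gen_closed.
  move=> _ [l ->] /=; rewrite map_mpolyX linear_substX.
  apply: ideal_closed_sum => [|i _]; first exact: ideal_gen_closed.
  rewrite -mul_mpolyC; apply: ideal_closedM; first exact: ideal_gen_closed.
  by apply: ideal_gen_incl; exists i.
move=> _ [i ->]; rewrite -(linear_substK 'X_i NM1) linear_substX raddf_sum /=.
apply: ideal_closed_sum => [|l _]; first exact: ideal_gen_closed.
rewrite comp_mpolyZ -mul_mpolyC; apply: ideal_closedM; first exact: ideal_gen_closed.
apply: ideal_gen_incl; exists 'X_l; first by apply: ideal_gen_incl; exists l.
by rewrite /= map_mpolyX.
Qed.

End LinearBaseChange.

(** * A linear form vanishing at none of the points *)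

Section NonvanishingForm.

Lemma pchar0_natr_inj (F : fieldType) :
  [pchar F] =i pred0 -> injective (fun n => n%:R : F).
Proof.
move=> /pcharf0P char0 m n; wlog le_mn : m n / (m <= n)%N => [wlog_mn eq_mn|/= /eqP].
  by case/orP: (leq_total m n) => le; [|symmetry]; apply: wlog_mn.
rewrite eq_sym -subr_eq0 -natrB // char0 subn_eq0 => le_nm.
by apply/eqP; rewrite eqn_leq le_mn.
Qed.

Lemma ex_natr_nonroot (F : fieldType) (p : {poly F}) :
  [pchar F] =i pred0 -> p != 0 -> exists n : nat, p.[n%:R] != 0.
Proof.
move=> char0 nz_p; apply: contrapT => /forallNP all_roots.
have := @max_poly_roots _ p [seq n%:R | n <- iota 0 (size p)] nz_p.
rewrite size_map size_iota ltnn => roots_lt; apply/notF/roots_lt.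
  by apply/allP => _ /mapP[n _ ->]; apply/contraT => /all_roots.
by rewrite map_inj_uniq ?iota_uniq //; apply: pchar0_natr_inj.
Qed.

Variables (k : fieldType) (L : fieldExtType k).
Hypothesis char0 : [pchar k] =i pred0.

Lemma base_changeZ n (M : 'M[L]_n) (c : k) f :
  base_change M (c *: f) = (in_alg L c)%:MP_[n] * base_change M f.
Proof.
rewrite -mul_mpolyC rmorphM; congr (_ * _).
by rewrite /= map_mpolyC comp_mpolyC.
Qed.

(** The form X_0 + s X_1 + s^2 X_2 takes at each point a value that is a nonzero
    polynomial in s, and some natural number is a root of none of the three. *)
Lemma ex_nonvanishing_form (M N : 'M[L]_3) : N *m M = 1%:M ->
  exists2 t, @irrelevant_ideal k 3 t
           & forall i, ~ weight_ge (deg_off i) 1 (base_change M t).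
Proof.
move=> NM1; pose p i := \poly_(l < 3) M (inord l) i.
have nz_p i : p i != 0.
  apply/eqP => pi0; have /matrixP/(_ i i)/eqP := NM1; rewrite !mxE eqxx big1.
    by rewrite eq_sym oner_eq0.
  move=> l _; have /(congr1 (fun q : {poly L} => q`_l)) := pi0.
  by rewrite coef_poly ltn_ord inord_val coef0 => ->; rewrite mulr0.
have [||s nz_ps] := @ex_natr_nonroot L (\prod_i p i).
- by move=> q; rewrite pchar_lalg.
- by apply/prodf_neq0 => i _.
exists (\sum_(l < 3) s%:R ^+ l *: 'X_l) => [|i].
  apply: ideal_closed_sum => [|l _]; first exact: ideal_gen_closed.
  rewrite -mul_mpolyC; apply: ideal_closedM; first exact: ideal_gen_closed.
  by apply: ideal_gen_incl; exists l.
have w0 : weight (deg_off i) U_(i)%MM = 0%N.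
  by rewrite /weight big1 // => j _; rewrite mnm1E /deg_off eq_sym; case: eqP.
move/(_ U_(i)%MM); rewrite w0 ltnn.
suff -> : (base_change M (\sum_(l < 3) s%:R ^+ l *: 'X_l))@_U_(i) = (p i).[s%:R].
  by move: nz_ps; rewrite horner_prod => /prodf_neq0/(_ i isT) nz_pi /(_ nz_pi).
rewrite [base_change M _]raddf_sum raddf_sum horner_poly; apply: eq_bigr => l _ /=.
rewrite [X in X@__]base_changeZ base_changeX mul_mpolyC mcoeffZ raddf_sum /=.
rewrite (bigD1 i) //= big1 => [|j nji]; last first.
  by rewrite mcoeffZ mcoeffXU (negPf nji) mulr0.
rewrite addr0 mcoeffZ mcoeffXU eqxx mulr1 inord_val mulrC.
by rewrite -[_%:A]/(in_alg L _) rmorphXn rmorph_nat.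
Qed.

End NonvanishingForm.

(** * Maximal minors of a pencil of 3 x 3 matrices *)

Section Minors.
Variable S : comNzRingType.
Implicit Types (X : 'M[S]_(2, 3)) (J : set S) (a b : 'I_3).

Definition minor2 X a b : S := X ord0 a * X ord_max b - X ord0 b * X ord_max a.

Lemma det_mx2 (B : 'M[S]_2) :
  \det B = B ord0 ord0 * B ord_max ord_max - B ord0 ord_max * B ord_max ord0.
Proof.
rewrite (expand_det_row _ ord0) !big_ord_recl big_ord0 /cofactor !det_mx11 !mxE /=.
rewrite addr0 expr0 mul1r expr1 mulN1r mulrN.
by congr (B _ _ * B _ _ - B _ _ * B _ _); apply: val_inj.
Qed.

Lemma minors2P X x :
  minors 2 X x <-> exists a b, (a < b)%N /\ x = minor2 X a b.
Proof.
split=> [[f [g [incr_f incr_g ->]]]|[a [b [lt_ab ->]]]].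
  exists (g ord0), (g ord_max); split; first exact: incr_g.
  have := incr_f ord0 ord_max isT; have := ltn_ord (f ord_max) => lt2 lt_f.
  have -> : minor2 X (g ord0) (g ord_max) = minor2 (mxsub f id X) (g ord0) (g ord_max).
    rewrite /minor2 !mxE; congr (X _ _ * X _ _ - X _ _ * X _ _);
    by apply: val_inj => /=; lia.
  by rewrite det_mx2 /minor2 !mxE.
exists id, (fun i => if i == ord0 then a else b); split=> //.
  by move=> [[|[|//]] lti] [[|[|//]] ltj].
by rewrite det_mx2 /minor2 !mxE.
Qed.

Lemma minor2_ideal X a b : ideal_gen (minors 2 X) (minor2 X a b).
Proof.
have [lt_ab|lt_ba|eq_ab] := ltngtP a b.
- by apply/ideal_gen_incl/minors2P; exists a, b.
- have -> : minor2 X a b = -1 * minor2 X b a by rewrite /minor2; ring.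
  apply: ideal_closedM; first exact: ideal_gen_closed.
  by apply/ideal_gen_incl/minors2P; exists b, a.
- have -> : minor2 X a b = 0 by rewrite (val_inj eq_ab) /minor2 subrr.
  exact: ideal_gen0.
Qed.

(** The minors of X *m W are combinations of those of X. *)
Lemma minor2_mul_ideal J X (W : 'M[S]_3) a b : ideal_closed J ->
  (forall p q, J (minor2 X p q)) -> J (minor2 (X *m W) a b).
Proof.
move=> clJ JX.
have -> : minor2 (X *m W) a b = \sum_p \sum_q W p a * W q b * minor2 X p q.
  rewrite /minor2 !mxE !big_distrlr /= [X in _ - X]exchange_big /= -sumrB.
  by apply: eq_bigr => p _; rewrite -sumrB; apply: eq_bigr => q _; ring.
apply: ideal_closed_sum => // p _; apply: ideal_closed_sum => // q _.
exact: ideal_closedM.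
Qed.

End Minors.

Section Pencil.
Variable S : comNzRingType.
Implicit Types v : 'I_18 -> S.

(** The coefficients of row a: the entry (l, j) is that of 'X_l in column j. *)
Definition coeff_matrix v (a : nat) : 'M[S]_3 :=
  \matrix_(l, j) v (inord (9 * a + 3 * j + l)).

Definition pencil_mx v : 'M[S]_3 := \adj (coeff_matrix v 1) *m coeff_matrix v 0.

(** The determinant of p'(G), for p the characteristic polynomial of G, is the
    product of the values of p' at the roots of p, hence up to sign the
    discriminant of p; in this form it commutes with ring morphisms. *)
Definition pencil_disc v : S :=
  \det (coeff_matrix v 1) * \det (horner_mx (pencil_mx v) (char_poly (pencil_mx v))^`()).

End Pencil.

Lemma map_coeff_matrix (S T : comNzRingType) (f : {rmorphism S -> T}) (v : 'I_18 -> S) a :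
  map_mx f (coeff_matrix v a) = coeff_matrix (f \o v) a.
Proof. by apply/matrixP => l j; rewrite !mxE. Qed.

Lemma map_pencil_mx (S T : comNzRingType) (f : {rmorphism S -> T}) (v : 'I_18 -> S) :
  map_mx f (pencil_mx v) = pencil_mx (f \o v).
Proof. by rewrite /pencil_mx map_mxM map_mx_adj !map_coeff_matrix. Qed.

Lemma map_pencil_disc (S T : comNzRingType) (f : {rmorphism S -> T}) (v : 'I_18 -> S) :
  f (pencil_disc v) = pencil_disc (f \o v).
Proof.
rewrite /pencil_disc rmorphM -!det_map_mx map_coeff_matrix map_horner_mx.
by rewrite -deriv_map map_char_poly map_pencil_mx.
Qed.

Section MinorsOfPencil.
Variables (k : fieldType) (L : fieldExtType k) (v : 'I_18 -> k).
Variables (M Q : 'M[L]_3) (d : 'rV[L]_3).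
Hypotheses (Qunit : Q \in unitmx) (inj_d : injective (d 0)).
Local Notation C a := (coeff_matrix (in_alg L \o v) a).
Hypothesis C0E : M^T *m C 0 *m Q = diag_mx d.
Hypothesis C1E : M^T *m C 1 *m Q = 1%:M.

Let phi := base_change M.
Let X := map_mx phi (linear_form_matrix v).
Let XQ := X *m map_mx (mpolyC 3 (R := L)) Q.
Let Y : 'rV[{mpoly L[3]}]_3 := \row_i 'X_i.

Lemma row_base_change_pencil (a : 'I_2) :
  row a XQ = Y *m map_mx (mpolyC 3 (R := L)) (M^T *m C a *m Q).
Proof.
rewrite row_mul !map_mxM !mulmxA; congr (_ *m _).
apply/rowP => j; rewrite !mxE raddf_sum; apply: eq_bigr => l _ /=.
rewrite [LHS]base_changeZ base_changeX mulrC !mxE; congr (_ * _).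
by apply: eq_bigr => i _; rewrite !mxE mulrC mul_mpolyC.
Qed.

Lemma pencil_entry0 j : XQ ord0 j = d 0 j *: 'X_j.
Proof.
have /rowP/(_ j) := row_base_change_pencil ord0; rewrite C0E mxE => ->.
rewrite mxE (bigD1 j) //= big1 ?addr0 => [|i nij]; rewrite !mxE.
  by rewrite eqxx mulr1n mulrC mul_mpolyC.
by rewrite (negPf nij) mulr0n mpolyC0 mulr0.
Qed.

Lemma pencil_entry1 j : XQ ord_max j = 'X_j.
Proof.
have /rowP/(_ j) := row_base_change_pencil ord_max; rewrite C1E mxE => ->.
rewrite mxE (bigD1 j) //= big1 ?addr0 => [|i nij]; rewrite !mxE.
  by rewrite eqxx mpolyC1 mulr1.
by rewrite (negPf nij) mpolyC0 mulr0.
Qed.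

Lemma minor2_pencil a b : minor2 XQ a b = (d 0 a - d 0 b) *: ('X_a * 'X_b).
Proof.
rewrite /minor2 !pencil_entry0 !pencil_entry1 -!scalerAl scalerBl.
by rewrite ['X_b * 'X_a]mulrC.
Qed.

Lemma extension_minors :
  extension phi (ideal_gen (minors 2 (linear_form_matrix v))) = @coord_points_ideal L.
Proof.
have phi_minor a b : phi (minor2 (linear_form_matrix v) a b) = minor2 X a b.
  by rewrite /minor2 rmorphB !rmorphM !mxE.
apply/seteqP; split; apply: ideal_gen_min; try exact: ideal_gen_closed.
  move=> _ [f If <-]; move: f If; apply: ideal_gen_min.
    exact/preimage_closed/ideal_gen_closed.
  move=> _ /minors2P[a [b [_ ->]]]; rewrite /= -[comp_mpoly _ _]/(phi _) phi_minor.
  have -> : X = XQ *m map_mx (mpolyC 3 (R := L)) (invmx Q).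
    by rewrite /XQ -mulmxA -map_mxM mulmxV // map_mx1 mulmx1.
  apply: minor2_mul_ideal => [|p q]; first exact: ideal_gen_closed.
  rewrite minor2_pencil -mul_mpolyC; have [->|neq_pq] := eqVneq p q.
    by rewrite subrr mpolyC0 mul0r; apply: ideal_gen0.
  apply: ideal_closedM; first exact: ideal_gen_closed.
  by apply: ideal_gen_incl; exists p, q.
move=> _ [i [j [neq_ij ->]]].
have nz_dij : d 0 i - d 0 j != 0 by rewrite subr_eq0 (inj_eq inj_d).
have -> : 'X_i * 'X_j = ((d 0 i - d 0 j)^-1)%:MP * minor2 XQ i j.
  by rewrite minor2_pencil mul_mpolyC scalerA mulVf // scale1r.
apply: ideal_closedM; first exact: ideal_gen_closed.
apply: minor2_mul_ideal => [|p q]; first exact: ideal_gen_closed.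
by rewrite -phi_minor; apply: extension_incl; apply: minor2_ideal.
Qed.

End MinorsOfPencil.

(** * General coefficients *)

(** With G Q = Q D for a diagonal D, the identity C_1 G = det(C_1) C_0 gives
    C_0 Q = C_1 Q D / det(C_1).  So the coordinates in which C_1 Q becomes the
    identity turn C_0 Q into a diagonal matrix. *)
Lemma splitting_coordinates (k : fieldType) (v : 'I_18 -> k) : pencil_disc v != 0 ->
  exists (L : fieldExtType k) (M N : 'M[L]_3),
    [/\ N *m M = 1%:M, M *m N = 1%:M
      & extension (base_change M) (ideal_gen (minors 2 (linear_form_matrix v)))
        = @coord_points_ideal L].
Proof.
move=> nz_disc.
have [L [zs split_chi]] :=
  ex_splitting_field (monic_neq0 (char_poly_monic (pencil_mx v))).
pose w := in_alg L \o v; pose G := pencil_mx w.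
have DG : char_poly G = \prod_(z <- zs) ('X - z%:P).
  apply/eqP; rewrite -eqp_monic ?char_poly_monic ?monic_prod_XsubC //.
  by rewrite /G /w -map_pencil_mx -map_char_poly.
have : pencil_disc w != 0 by rewrite /w -map_pencil_disc fmorph_eq0.
rewrite mulf_eq0 negb_or => /andP[nz_detC nz_disc_w].
have [Q [d [Qunit GQ inj_d]]] := diagonalize_separable DG nz_disc_w.
pose C := coeff_matrix w; pose delta := \det (C 1).
have CQunit : C 1 *m Q \in unitmx by rewrite unitmx_mul Qunit andbT unitmxE unitfE.
exists L, (invmx (C 1 *m Q))^T, (C 1 *m Q)^T.
split; first by rewrite -trmx_mul mulVmx // trmx1.
  by rewrite -trmx_mul mulmxV // trmx1.
have C0Q : C 0 *m Q = (C 1 *m Q) *m diag_mx (delta^-1 *: d).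
  have -> : diag_mx (delta^-1 *: d) = delta^-1 *: diag_mx d by rewrite linearZ.
  rewrite -scalemxAr -mulmxA -GQ mulmxA /G /pencil_mx mulmxA mul_mx_adj.
  by rewrite mul_scalar_mx -scalemxAl scalerA mulVf // scale1r.
apply: (@extension_minors _ _ _ _ Q (delta^-1 *: d)) => //.
- by move=> i j; rewrite !mxE => /(mulfI (invr_neq0 nz_detC))/inj_d.
- by rewrite trmxK -mulmxA C0Q mulKmx.
- by rewrite trmxK -mulmxA mulVmx.
Qed.

Lemma annihilator_symbolic_pow (k : fieldType) (v : 'I_18 -> k) (d : nat)
    (I := ideal_gen (minors 2 (linear_form_matrix v))) :
    [pchar k] =i pred0 -> pencil_disc v != 0 ->
  annihilator_quot (symbolic_pow I d) (ideal_pow I d)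
  = ideal_pow (@irrelevant_ideal k 3) d./2.
Proof.
move=> char0 /splitting_coordinates[L [M [N [NM1 MN1 extI]]]].
have [n [e [pi basis_e]]] := base_change_free NM1 MN1.
have ext_irr := extension_irrelevant NM1.
have clI : ideal_closed I by apply: ideal_gen_closed.
have [t mt nVt] := ex_nonvanishing_form char0 NM1.
apply/seteqP; split=> r.
  apply: (annihilator_sub basis_e clI extI ext_irr mt).
  exact/(compl_assoc_primesP basis_e clI extI).
by move=> mr f If; apply: (irrelevant_pow_annihilates basis_e clI extI ext_irr If).
Qed.

(** The coefficients with C_1 the identity and C_0 = diag(0, 1, 2), that is the
    matrix with rows (0, x_1, 2 x_2) and (x_0, x_1, x_2). *)
Definition diagonal_pencil (k : fieldType) (i : 'I_18) : k :=
  let l := ((i %% 9) %/ 3)%N in let j := (i %% 3)%N in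
  if l != j then 0 else if (i < 9)%N then l%:R else 1.

Lemma pencil_disc_diagonal (k : fieldType) : [pchar k] =i pred0 ->
  pencil_disc (@diagonal_pencil k) != 0.
Proof.
move=> char0; pose d : 'rV[k]_3 := \row_i i%:R.
have C1 : coeff_matrix (@diagonal_pencil k) 1 = 1%:M.
  apply/matrixP => l j; rewrite !mxE /diagonal_pencil inordK; last first.
    by have := ltn_ord l; have := ltn_ord j; lia.
  by move: l j; do 2!apply: ord3_ind.
have C0 : coeff_matrix (@diagonal_pencil k) 0 = diag_mx d.
  apply/matrixP => l j; rewrite !mxE /diagonal_pencil inordK; last first.
    by have := ltn_ord l; have := ltn_ord j; lia.
  by move: l j; do 2!apply: ord3_ind.
have adj1 : \adj (1%:M : 'M[k]_3) = 1%:M.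
  by have := mul_mx_adj (1%:M : 'M[k]_3); rewrite mul1mx det1.
rewrite /pencil_disc /pencil_mx C1 C0 adj1 mul1mx det1 mul1r horner_mx_diag det_diag.
have -> : char_poly (diag_mx d) = \prod_(i < 3) ('X - i%:R%:P).
  by rewrite char_poly_trig ?diag_mx_is_trig //; apply: eq_bigr => i _; rewrite !mxE eqxx.
apply/prodf_neq0 => i _; rewrite !mxE big_ord3 /=.
rewrite !derivM !derivXsubC !hornerE.
have nz2 : 2%:R != 0 :> k by have /pcharf0P -> := char0.
move: i; apply: ord3_ind => /=.
- by rewrite [X in X != 0](_ : _ = 2%:R) //; ring.
- by rewrite [X in X != 0](_ : _ = -1) ?oppr_eq0 ?oner_eq0 //; ring.
- by rewrite [X in X != 0](_ : _ = 2%:R) //; ring.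
Qed.

Theorem mainTheorem4 (k : fieldType) (k_char0 : [pchar k] =i pred0) :
  exists U : set ('I_18 -> k),
    [/\ zariski_open U, U !=set0
      & forall v : 'I_18 -> k, U v ->
        forall I : set {mpoly k[3]},
          I = ideal_gen (minors 2 (linear_form_matrix v)) ->
        forall d : nat, (1 <= d)%N ->
          annihilator_quot (symbolic_pow I d) (ideal_pow I d)
          = ideal_pow (@irrelevant_ideal k 3) (d./2)].
Proof.
pose D : {mpoly k[18]} := pencil_disc (fun i => 'X_i).
have evalD v : D.@[v] = pencil_disc v.
  rewrite (map_pencil_disc (meval v)); congr pencil_disc.
  by apply/funext => i /=; rewrite mevalXU.
exists [set v | pencil_disc v != 0]; split.
- exists [set D]; apply/seteqP; split=> v /=.
    by move=> nz_disc /(_ D erefl)/eqP; rewrite evalD (negPf nz_disc).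
  by move=> nz_D; apply/negP => /eqP disc0; apply: nz_D => _ ->; rewrite evalD.
- by exists (@diagonal_pencil k); apply: pencil_disc_diagonal.
- by move=> v nz_disc _ -> d _; apply: annihilator_symbolic_pow.
Qed.
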